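(* If $\kappa$ is a weakly compact cardinal and $I$ is a normal ideal on $\kappa$ which is definable over $H_{\kappa^+}$, then $I$ is nowhere $\kappa$-saturated.
   Context: $H_{\kappa^+}$ is the set of all sets of hereditary cardinality at most $\kappa$. For an ideal $I$ on $\kappa$, $I^+=\{X\subseteq\kappa\mid X\notin I\}$, and for $S\in I^+$, $I\upharpoonright S=\{X\subseteq\kappa\mid X\cap S\in I\}$. Ideals on $\kappa$ are assumed to contain $[\kappa]^{<\kappa}$. $I$ is normal if for all $S\in I^+$ and every $f:S\to\kappa$ with $f(\alpha)<\alpha$ for all $\alpha\in S$, there is $H\in P(S)\cap I^+$ with $f\upharpoonright H$ constant (equivalently, $I$ is closed under diagonal unions of length $\kappa$). $I$ is $\kappa$-saturated if the boolean algebra $P(\kappa)/I$ has the $\kappa$-chain condition, i.e. there is no family of $\kappa$ many $I$-positive sets with pairwise intersections in $I$. $I$ is nowhere $\kappa$-saturated if for every $S\in I^+$ the ideal $I\upharpoonright S$ is not $\kappa$-saturated. *)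

(* Defs.v *)
From mathcomp Require Import all_boot all_order.
From mathcomp Require Import boolp classical_sets functions cardinality.
From Stdlib Require Import Relation_Operators.

Set Implicit Arguments.
Unset Strict Implicit.
Unset Printing Implicit Defensive.

Local Open Scope classical_set_scope.
Local Open Scope card_scope.
Local Open Scope order_scope.

(** The universe of sets: well-founded trees of arbitrary branching, taken up
    to the extensional equality [Veq]. *)
Inductive V : Type := sup (A : Type) (f : A -> V).

Fixpoint Veq (x y : V) : Prop :=
  let: sup A f := x in let: sup B g := y in
  (forall a, exists b, Veq (f a) (g b)) /\ (forall b, exists a, Veq (f a) (g b)).

Definition Vmem (x y : V) : Prop := let: sup B g := y in exists b, Veq x (g b).

(** [intc y x]: [y] belongs to the transitive closure of [x]. *)
Definition intc : V -> V -> Prop := clos_trans V Vmem.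

Inductive formula : Type :=
| FMem (i j : nat)
| FEq (i j : nat)
| FNot (p : formula)
| FAnd (p q : formula)
| FAll (i : nat) (p : formula).

Definition upd (e : nat -> V) (i : nat) (x : V) : nat -> V :=
  fun j => if j == i then x else e j.

(** Tarski satisfaction in the structure [(D, Vmem)]. *)
Fixpoint sat (D : V -> Prop) (e : nat -> V) (p : formula) : Prop :=
  match p with
  | FMem i j => Vmem (e i) (e j)
  | FEq i j => Veq (e i) (e j)
  | FNot p => ~ sat D e p
  | FAnd p q => sat D e p /\ sat D e q
  | FAll i p => forall x, D x -> sat D (upd e i x) p
  end.

(** Definability with parameters: variable 0 is the defined element, the other
    free variables (finitely many) denote parameters from [D]. *)
Definition definable_over (D C : V -> Prop) : Prop :=
  exists (p : formula) (e : nat -> V),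
    (forall i, D (e i)) /\ (forall x, D x -> (C x <-> sat D (upd e 0 x) p)).

Section Cardinal.
Context {d : Order.disp_t} {K : orderType d}.

(** A well-ordered type represents a cardinal when its order is initial. *)
Definition is_cardinal : Prop :=
  well_founded (fun a b : K => a < b) /\
  forall a : K, ~ ([set: K] #<= [set b | b < a]).

(** A colouring of [K]^2 with two colours is a function on pairs [a < b]; its
    values at the other pairs are ignored. *)
Definition weakly_compact : Prop :=
  [/\ is_cardinal,
      ~ countable [set: K] &
      forall c : K -> K -> bool, exists H : set K,
        H #= [set: K] /\
        exists i : bool, forall a b, H a -> H b -> a < b -> c a b = i].

(** Properness is not required: for the improper ideal there are no positive
    sets. *)
Definition is_ideal (I : set (set K)) : Prop :=
  [/\ forall A B, A `<=` B -> I B -> I A,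
      forall A B, I A -> I B -> I (A `|` B) &
      forall A, ~ ([set: K] #<= A) -> I A].

Definition positive (I : set (set K)) : set (set K) := [set S | ~ I S].

Definition restrict_ideal (I : set (set K)) (S : set K) : set (set K) :=
  [set X | I (X `&` S)].

Definition normal_ideal (I : set (set K)) : Prop :=
  is_ideal I /\
  forall S, positive I S ->
  forall f : K -> K, (forall a, S a -> f a < a) ->
  exists H, [/\ H `<=` S, positive I H & exists c, forall a, H a -> f a = c].

Definition saturated (I : set (set K)) : Prop :=
  ~ exists F : K -> set K,
      (forall a, positive I (F a)) /\
      (forall a b, a != b -> I (F a `&` F b)).

Definition nowhere_saturated (I : set (set K)) : Prop :=
  forall S, positive I S -> ~ saturated (restrict_ideal I S).

(** The class of sets whose transitive closure has cardinality at most that of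
    [K]; as equality of sets is [Veq], this bound is expressed by an enumeration
    of the transitive closure. *)
Definition Hplus (x : V) : Prop :=
  exists f : K -> V, forall y, intc y x -> exists a, Veq y (f a).

Section Code.
Context (wfK : well_founded (fun a b : K => a < b)).

(** The von Neumann ordinal of [a]. *)
Definition vN : K -> V :=
  Fix wfK (fun _ => V)
    (fun a rec => @sup {b : K | b < a} (fun b => rec (sval b) (svalP b))).

Definition vset (X : set K) : V := @sup {a : K | X a} (fun a => vN (sval a)).

(** [I] as a class of elements of [V], namely of sets of ordinals. *)
Definition vclass (I : set (set K)) (x : V) : Prop :=
  exists2 X, I X & Veq x (vset X).

Definition definable_over_Hplus (I : set (set K)) : Prop :=
  definable_over Hplus (vclass I).
End Code.

End Cardinal.

Arguments is_cardinal {d} K.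
Arguments weakly_compact {d} K.
Arguments Hplus {d} K.

(* Main.v *)
(** If [I] restricted to some positive [S] were saturated, then [I] would have an
    atom below [S]: otherwise split [S] repeatedly into a tree of positive sets.
    Lexicographic colourings show that almost every point of [S] survives to each
    given level and that some branch of length [K] runs through positive nodes; the
    sets splitting off that branch are positive, pairwise disjoint, and [K] many.

    The dual of [I] below an atom is a normal ultrafilter [W] on [K].  By the theorem
    of Los, applied to the structures [Hbelow b] whose ultraproduct collapses to
    [Hplus K], the definition of [I] reflects to a sequence [U b] of families of
    subsets of [b] such that [W X] holds iff [U b (X & b)] does for [W]-almost all [b];
    that is, [W] lies in its own ultrapower.  Normality then makes almost every [U b]
    again a normal ultrafilter represented by the same sequence, so there would be an
    infinite descent through the ordinals [b]. *)
Require Import Defs.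
From mathcomp Require Import all_boot all_order.
From mathcomp Require Import boolp classical_sets functions cardinality.
From Stdlib Require Import Relation_Operators.

Set Implicit Arguments.
Unset Strict Implicit.
Unset Printing Implicit Defensive.

Local Open Scope classical_set_scope.
Local Open Scope card_scope.
Local Open Scope order_scope.
Import Order.TTheory.

(** * Cardinal comparison through injections *)

Lemma injective_on_card_le T U (A : set T) (B : set U) (f : T -> U) :
  (forall x, A x -> B (f x)) ->
  (forall x y, A x -> A y -> f x = f y -> x = y) -> A #<= B.
Proof.
move=> fAB finj.
have fi : {in A &, injective f} by move=> x y /set_mem Ax /set_mem Ay; apply: finj.
have := inj_card_eq fi; rewrite card_eq_sym => /card_eqPle[le _].
by apply: card_le_trans le _; apply: subset_card_le => _ [x Ax <-]; apply: fAB.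
Qed.

Lemma card_le_injection T U (R : set U) : [set: T] #<= R ->
  exists j : T -> U, (forall x, R (j x)) /\ injective j.
Proof.
move=> /card_leP/unsquash f.
exists (fun x => set_val (f (to_setT x))); split=> [x|x y].
  exact: set_valP.
move=> /val_inj /(@inj _ _ _ f); rewrite !inE => /(_ I I).
by move=> /(congr1 val).
Qed.

(** * Normal ideals on an uncountable cardinal *)

Section NormalIdeal.
Context {d : Order.disp_t} {K : orderType d}.
Context (wfK : well_founded (fun a b : K => a < b)).
Context (I : set (set K)).
Hypothesis cardK : is_cardinal K.
Hypothesis uncK : ~ countable [set: K].
Hypothesis nI : normal_ideal I.

Lemma null_sub (A B : set K) : A `<=` B -> I B -> I A.
Proof. by case: nI => -[+ _ _] _; apply. Qed.

Lemma null_setU (A B : set K) : I A -> I B -> I (A `|` B).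
Proof. by case: nI => -[_ + _] _; apply. Qed.

Lemma positive_card (A : set K) : positive I A -> [set: K] #<= A.
Proof. by case: nI => -[_ _ h] _ pA; apply: contrapT => /h. Qed.

Lemma positive_sub (A B : set K) : A `<=` B -> positive I A -> positive I B.
Proof. by move=> AB pA /(null_sub AB). Qed.

Lemma positive_setD (A B : set K) : positive I A -> I B -> positive I (A `\` B).
Proof.
move=> pA IB IAB; apply: pA; apply: null_sub (null_setU IAB IB) => x Ax.
by have [Bx|nBx] := pselect (B x); [right|left].
Qed.

Lemma null_countable (A : set K) : countable A -> I A.
Proof. by move=> cA; apply: contrapT => /positive_card /sub_countable/(_ cA). Qed.

Lemma null_lt (c : K) : I [set b | b < c].
Proof. by apply: contrapT => /positive_card; apply: cardK.2. Qed.

Lemma null_le (c : K) : I [set b | b <= c].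
Proof.
apply: (null_sub _ (null_setU (null_lt c) (null_countable (countable1 c)))).
by move=> b /=; rewrite le_eqVlt => /orP[/eqP ->|]; [right|left].
Qed.

Lemma regressive_relation (P : set K) (Q : K -> K -> Prop) : positive I P ->
  (forall b, P b -> exists c, c < b /\ Q b c) ->
  exists c, positive I (P `&` [set b | Q b c]).
Proof.
move=> pP hQ.
have /choice[f hf] : forall b, exists c, P b -> c < b /\ Q b c.
  move=> b; have [/hQ[c hc]|nP] := pselect (P b); first by exists c.
  by exists b.
have [H [HP pH [c fc]]] := nI.2 P pP f (fun b Pb => (hf b Pb).1).
exists c; apply: positive_sub pH => b Hb; split; first exact: HP.
by rewrite /= -(fc _ Hb); apply: (hf b (HP _ Hb)).2.
Qed.

(** Keep the least point of [P] in each fibre of [h]. If these points formed a null set, the rest of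
    [P] would be positive and carry a regressive map to smaller points of the same fibre; normality
    makes it constant, so some fibre would be positive. *)
Lemma positive_transversal T (h : K -> T) (P : set K) : positive I P ->
  (forall c, I (P `&` [set b | h b = h c])) ->
  exists R : set K, [/\ R `<=` P, positive I R &
    forall b c, R b -> R c -> h b = h c -> b = c].
Proof.
move=> pP hP.
exists (P `&` [set b | forall c, P c -> h c = h b -> ~ c < b]); split.
- by move=> b [].
- move=> IR; have [] := @regressive_relation _ (fun b c => h b = h c) (positive_setD pP IR).
    move=> b [Pb nb]; apply: contrapT => nc; apply: nb; split=> // c Pc hc cb.
    by apply: nc; exists c.
  move=> c pc; apply: pc; apply: null_sub (hP c) => b [[Pb _] hb]; by split.
- move=> b c [Pb mb] [Pc mc] hbc.
  have [bc|cb|//] := ltgtP b c; first by case: (mc _ Pb hbc).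
  by case: (mb _ Pc (esym hbc)).
Qed.

(** Sending [b] to the index of a member containing it has null fibres, so a positive union would
    contain a transversal of full size, injecting into the naturals. *)
Lemma null_bigcup_nat (P : nat -> set K) : (forall n, I (P n)) ->
  I [set b | exists n, P n b].
Proof.
move=> IP; apply: contrapT => pU.
have /choice[h hh] : forall b, exists n, [set b | exists n, P n b] b -> P n b.
  move=> b; have [[n Pn]|nP] := pselect (exists n, P n b); first by exists n.
  by exists 0%N.
have [|R [RU pR hi]] := @positive_transversal _ h _ pU.
  by move=> c; apply: null_sub (IP (h c)) => b [Ub /= <-]; apply: hh.
apply: uncK; apply: card_le_trans (positive_card pR) _.
by apply: (@injective_on_card_le _ _ _ _ h).
Qed.

(** If [f] were unbounded below [a], a map sending [c] to some [b < a] with [c < f b] would have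
    bounded, hence null, fibres; a positive transversal would inject [K] into the segment below
    [a]. *)
Lemma cardinal_regular (S : set K) : positive I S ->
  forall (a : K) (f : K -> K), exists c, forall b, b < a -> f b <= c.
Proof.
move=> pS a f; apply: contrapT => nc.
have /choice[g hg] : forall c, exists b, b < a /\ c < f b.
  move=> c; apply: contrapT => nb; apply: nc; exists c => b ba.
  by rewrite leNgt; apply/negP => cb; apply: nb; exists b.
have [|R [RS pR gi]] := @positive_transversal _ g _ pS.
  move=> c; apply: null_sub (null_lt (f (g c))) => b [_ /= <-].
  exact: (hg b).2.
apply: (cardK.2 a); apply: card_le_trans (positive_card pR) _.
by apply: (@injective_on_card_le _ _ _ _ g) => // b _; apply: (hg b).1.
Qed.

Lemma full_card_unbounded (S H : set K) : positive I S -> [set: K] #<= H ->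
  forall a, exists b, H b /\ a < b.
Proof.
move=> pS KH a; apply: contrapT => nb.
have [c ac] : exists c, a < c.
  apply: contrapT => nc; apply: pS; apply: null_sub (null_le a) => b _ /=.
  by rewrite leNgt; apply/negP => ab; apply: nc; exists b.
apply: (cardK.2 c); apply: card_le_trans KH _; apply: subset_card_le => b Hb /=.
apply: le_lt_trans ac; rewrite leNgt; apply/negP => ab.
by apply: nb; exists b.
Qed.

(** * The partition property and the splitting tree *)

Hypothesis partK : forall c : K -> K -> bool, exists H : set K,
  H #= [set: K] /\ exists i : bool, forall a b, H a -> H b -> a < b -> c a b = i.

(* Colour a pair by whether [s a] precedes [s b] lexicographically; on a
   homogeneous set the sequence is lexicographically monotone. *)
Lemma branches_stabilize (S : set K) (s : K -> K -> bool) : positive I S ->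
  exists H : set K, (forall a, exists b, H b /\ a < b) /\
  forall c, exists a0, forall a b, H a -> H b -> a0 <= a -> a0 <= b ->
    forall e, e < c -> s a e = s b e.
Proof.
move=> pS.
have [H [HK [i hi]]] := partK (fun a b => `[< exists e,
  [/\ s a e = false, s b e = true & forall e', e' < e -> s a e' = s b e'] >]).
exists H; split.
  by apply: full_card_unbounded pS _; move: HK; rewrite card_eq_sym => /card_eqPle[].
(* Regularity bounds the thresholds of the single coordinates by a common one. *)
have stable_below c : (forall e, e < c -> exists a0, forall a b, H a -> H b ->
      a0 <= a -> a0 <= b -> s a e = s b e) ->
    exists a0, forall a b, H a -> H b -> a0 <= a -> a0 <= b ->
      forall e, e < c -> s a e = s b e.
  move=> hc; have /choice[f hf] : forall e, exists a0, e < c -> forall a b, H a -> H b ->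
      a0 <= a -> a0 <= b -> s a e = s b e.
    move=> e; have [/hc[a0 h0]|ec] := boolP (e < c); first by exists a0.
    by exists e.
  have [a0 h0] := cardinal_regular pS c f.
  exists a0 => a b Ha Hb a0a a0b e ec.
  by apply: hf => //; [apply: le_trans a0a|apply: le_trans a0b]; apply: h0.
move=> c; apply: (stable_below c) => e _.
elim/(well_founded_induction wfK): e => e /stable_below[a0 h0].
(* Once the coordinates below [e] are settled, homogeneity allows coordinate [e] to change only
   towards [i], hence at most once. *)
have mono a b : H a -> H b -> a0 <= a -> a < b -> s a e = i -> s b e = i.
  move=> Ha Hb a0a ab; have a0b := le_trans a0a (ltW ab).
  have eqs := h0 a b Ha Hb a0a a0b.
  move: (hi a b Ha Hb ab); case: (i) => [/asboolP[e' [sa sb eq']]|/asboolPn nlex].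
    have [/eqs|ee'|ee'] := ltgtP e' e; first by rewrite sa sb.
      by rewrite (eq' _ ee').
    by rewrite -ee' sb.
  move=> sa; apply/negbTE/negP => sb; apply: nlex; exists e; split=> //.
have [[a1 [H1 a01 s1]]|no] := pselect (exists a1, [/\ H a1, a0 <= a1 & s a1 e = i]).
  have si a : H a -> a1 <= a -> s a e = i.
    by move=> Ha; rewrite le_eqVlt => /orP[/eqP <-//|]; move=> /mono; apply.
  by exists a1 => a b Ha Hb a1a a1b; rewrite !si.
have ns a : H a -> a0 <= a -> s a e = ~~ i.
  move=> Ha a0a; have : s a e <> i by move=> sa; apply: no; exists a.
  by case: (s a e) (i) => -[].
by exists a0 => a b Ha Hb a0a a0b; rewrite !ns.
Qed.

Section SplittingTree.
Context (S : set K) (split : set K -> set K).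
Hypothesis pS : positive I S.
Hypothesis split_positive : forall A, A `<=` S -> positive I A ->
  positive I (A `&` split A) /\ positive I (A `\` split A).

(* [side a x] tells on which side of the split of its level-[a] node the point
   [x] lies; a node consists of the points which took the same sides so far. *)
Definition side : K -> K -> bool :=
  Fix wfK (fun _ => K -> bool) (fun a rec x =>
    `[< split (S `&` [set y | forall b (ba : b < a), rec b ba y = rec b ba x]) x >]).

Definition node (a : K) (t : K -> bool) : set K :=
  S `&` [set y | forall b, b < a -> side b y = t b].

Lemma sideE a x : side a x = `[< split (node a (side^~ x)) x >].
Proof.
rewrite /side Fix_eq // => {}a f g fg.
have -> // : f = g by apply: functional_extensionality_dep => b;
  apply: functional_extensionality_dep => ba; apply: fg.
Qed.

Lemma eq_node a (t u : K -> bool) : (forall b, b < a -> t b = u b) -> node a t = node a u.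
Proof.
move=> tu; apply/seteqP; split=> y [Sy h]; split=> // b ba; rewrite h //.
  exact: tu.
by rewrite tu.
Qed.

Lemma side_node a t x : node a t x -> side a x = `[< split (node a t) x >].
Proof. by move=> [_ tx]; rewrite sideE; congr (`[< split _ x >]); apply: eq_node. Qed.

(** Otherwise a transversal yields [K] many points lying in distinct nodes of level [a], whereas two
    of them must agree on all coordinates below [a] once their branches stabilize. *)
Lemma null_levels a : I (S `&` [set x | I (node a (side^~ x))]).
Proof.
apply: contrapT => pZ.
have [|R [RZ pR hi]] := @positive_transversal _ (fun x => node a (side^~ x)) _ pZ.
  move=> c; have [Ic|nIc] := pselect (I (node a (side^~ c))).
    by apply: null_sub Ic => b [[Sb _] /= <-]; split.
  have -> : S `&` [set x | I (node a (side^~ x))]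
    `&` [set b | node a (side^~ b) = node a (side^~ c)] = set0.
    by apply/seteqP; split=> // b [[_ /= Ib] bc]; rewrite bc in Ib.
  exact: null_countable.
have [j [jR ji]] := card_le_injection (positive_card pR).
have [H [ubH stH]] := branches_stabilize (fun b e => side e (j b)) pR.
have [a0 h0] := stH a.
have [b [Hb ab]] := ubH a0; have [c [Hc bc]] := ubH b.
suff : b = c by move=> E; rewrite E ltxx in bc.
apply: ji; apply: hi => //; apply: eq_node.
exact: h0 Hb Hc (ltW ab) (ltW (lt_trans ab bc)).
Qed.

(** Choose a point in a positive node of each level and let [t] be the limit of their stabilizing
    branches. Each node along [t] contains the positive node of a chosen point at a higher level. *)
Lemma positive_branch : exists t, forall a, positive I (node a t).
Proof.
have /choice[x hx] : forall a, exists x, S x /\ positive I (node a (side^~ x)).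
  move=> a; apply: contrapT => nx; apply: pS; apply: null_sub (null_levels a) => x Sx.
  by split=> //; apply: contrapT => px; apply: nx; exists x.
have [H [ubH stH]] := branches_stabilize (fun b e => side e (x b)) pS.
have /choice[f hf] : forall a, exists b, [/\ H b, a < b & forall c, H c -> b <= c ->
    forall e, e <= a -> side e (x c) = side e (x b)].
  (* [stH] settles only the coordinates strictly below its argument; taking [a'] above [a] includes
     coordinate [a] itself. *)
  move=> a; have [a' [_ aa']] := ubH a; have [a0 h0] := stH a'.
  have [b [Hb ab]] := ubH (Order.max a a0).
  move: ab; rewrite gt_max => /andP[ab a0b].
  exists b; split=> // c Hc bc e ea.
  by apply: h0 => //; [apply: le_trans (ltW a0b) bc|exact: ltW|exact: le_lt_trans aa'].
exists (fun a => side a (x (f a))) => a.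
apply: positive_sub (hx (f a)).2 => y [Sy hy]; split=> // e ea /=.
have [Ha fa sa] := hf a; have [He fe se] := hf e.
rewrite hy; last exact: lt_trans fa.
have [le|/ltW le] := leP (f e) (f a); first by apply: se.
by apply/esym/sa => //; exact: ltW.
Qed.

Lemma splitting_not_saturated : ~ saturated (restrict_ideal I S).
Proof.
apply; have [t pt] := positive_branch.
have pD a : positive I (node a t `&` [set x | side a x <> t a]).
  have [pos neg] := split_positive (@subIsetl _ S _) (pt a).
  have [ta|ta] := boolP (t a).
    apply: positive_sub neg => x [nx sx]; split=> //=.
    by rewrite (side_node nx) asboolF.
  apply: positive_sub pos => x [nx sx]; split=> //=.
  by rewrite (side_node nx) asboolT // => E; rewrite -E in ta.
exists (fun a => node a t `&` [set x | side a x <> t a]); split=> [a|a b nab].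
  apply: (positive_sub (B := _ `&` S)) (pD a) => x [[Sx tx] sx]; do !split=> //.
have nI0 : I set0 by exact: null_countable.
apply: null_sub nI0 => x [[[[_ nxa] sa] [[_ nxb] sb]] _].
(* A point in the node of the higher level still follows [t] at the lower one, so it did not split
   off there. *)
by move: nab; rewrite neq_lt => /orP[/nxb|/nxa].
Qed.
End SplittingTree.

Lemma saturated_atom (S : set K) : positive I S -> saturated (restrict_ideal I S) ->
  exists A, [/\ A `<=` S, positive I A & forall X, I (A `&` X) \/ I (A `\` X)].
Proof.
move=> pS satS; apply: contrapT => na.
have /choice[split hs] : forall A, exists X, A `<=` S -> positive I A ->
    positive I (A `&` X) /\ positive I (A `\` X).
  move=> A; apply: contrapT => nX; apply: na; exists A; split.
  - by apply: contrapT => nAS; apply: nX; exists set0.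
  - by move=> IA; apply: nX; exists set0.
  - move=> X; have [|nIX] := pselect (I (A `&` X)); first by left.
    right; apply: contrapT => nIDX; apply: nX; exists X; split; by [].
exact: (@splitting_not_saturated S split pS hs).
Qed.
End NormalIdeal.

(** * Normal measures and their reflection to initial segments *)

Section NormalMeasure.
Context {d : Order.disp_t} {K : orderType d}.
Implicit Types (D : set K) (W : set (set K)) (U : K -> set (set K)).

(* [W] is meant as a normal ultrafilter on the initial segment [D], its elements
   being considered only up to their trace on [D]. *)
Record normal_measure D W : Prop := NormalMeasure {
  nm_ext : forall X Y : set K, (forall a, D a -> (X a <-> Y a)) -> W X -> W Y;
  nm_not : forall P : K -> Prop, W [set b | ~ P b] <-> ~ W [set b | P b];
  nm_and : forall P Q : K -> Prop,
    W [set b | P b /\ Q b] <-> W [set b | P b] /\ W [set b | Q b];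
  nm_gt : forall a, D a -> W [set b | a < b];
  nm_regress : forall P : K -> K -> Prop, W [set b | exists c, c < b /\ P b c] ->
    exists c, D c /\ W [set b | P b c] }.

(** In the ultrapower by [W], the sequence [U] stands for [W] itself. *)
Definition self_representing W U := forall X : set K, W X <-> W [set b | U b X].

Section Theory.
Context (D : set K) (W : set (set K)) (nW : normal_measure D W).
Implicit Types P Q : K -> Prop.

Lemma nm_impl P Q : W [set b | P b -> Q b] <-> (W [set b | P b] -> W [set b | Q b]).
Proof.
have -> : [set b | P b -> Q b] = [set b | ~ (P b /\ ~ Q b)].
  apply/seteqP; split=> b /= h; first by case=> /h.
  by move=> Pb; apply: contrapT => nQ; apply: h.
rewrite (nm_not nW) (nm_and nW) (nm_not nW); split=> [h WP|h [/h]//].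
by apply: contrapT => nQ; apply: h.
Qed.

Lemma nm_iff P Q : W [set b | P b <-> Q b] <-> (W [set b | P b] <-> W [set b | Q b]).
Proof. by rewrite (nm_and nW) !nm_impl. Qed.

Lemma nm_all P : (forall b, D b -> P b) -> W [set b | P b].
Proof.
move=> hP; have WT : W [set b | True -> True] by apply/nm_impl.
by apply: (nm_ext nW) WT => b Db; split=> // _; apply: hP.
Qed.

Lemma nm_sub P Q : (forall b, D b -> P b -> Q b) -> W [set b | P b] -> W [set b | Q b].
Proof. by move=> PQ; apply/nm_impl; apply: nm_all. Qed.

Lemma nm_ex P : W [set b | P b] -> exists b, D b /\ P b.
Proof.
move=> WP; apply: contrapT => nP.
have : W [set b | ~ P b] by apply: nm_all => b Db Pb; apply: nP; exists b.
by move/(nm_not nW).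
Qed.

(** Failure at almost all [b] would pick a bad [c < b], and regressivity would fix this [c]. *)
Lemma nm_diag (P : K -> K -> Prop) : (forall c, D c -> W [set b | P c b]) ->
  W [set b | forall c, c < b -> P c b].
Proof.
move=> hP; apply: contrapT => /(nm_not nW) WnP.
have [|c [Dc]] := @nm_regress _ _ nW (fun b c => ~ P c b).
  apply: nm_sub WnP => b _ nPb; apply: contrapT => nc; apply: nPb => c cb.
  by apply: contrapT => nPc; apply: nc; exists c.
by move/(nm_not nW); apply; apply: hP.
Qed.

(** [W] votes on each point [c], and the diagonal intersection collects the votes. This merges
    counterexamples chosen separately at each [b] into a single one. *)
Lemma nm_glue (X : K -> set K) :
  exists Y : set K, W [set b | forall c, c < b -> (Y c <-> X b c)].
Proof.
exists [set c | W [set b | X b c]]; apply: nm_diag => c _.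
have [WX|nWX] := pselect (W [set b | X b c]).
  by apply: (nm_sub _ WX) => b _ Xbc; split.
by apply: (nm_sub _ ((nm_not nW _).2 nWX)) => b _ nXbc; split.
Qed.

Lemma nm_glue2 (X : K -> K -> set K) : exists Y : K -> set K,
  W [set b | forall c, c < b -> forall e, e < b -> (Y c e <-> X b c e)].
Proof.
have /choice[Y hY] := fun c => nm_glue (fun b => X b c).
by exists Y; apply: nm_diag.
Qed.

End Theory.

(* The sequence [U] reflects to its own members: a failure of one of the
   properties at almost all [b] would glue, by normality, to a failure for [W]. *)
Lemma self_representing_reflects D W U :
  (forall b (X Y : set K), (forall a, a < b -> (X a <-> Y a)) -> U b X -> U b Y) ->
  normal_measure D W -> self_representing W U ->
  exists b, [/\ D b, normal_measure [set a | a < b] (U b) & self_representing (U b) U].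
Proof.
move=> extU nW sW.
have extU' b (X Y : set K) : (forall a, a < b -> (X a <-> Y a)) -> U b X <-> U b Y.
  by move=> XY; split; apply: extU => a ab; split=> /XY; apply.
have notU : W [set b | forall X : set K, U b [set a | ~ X a] <-> ~ U b X].
  apply: contrapT => /(nm_not nW) Wn.
  have /choice[X hX] : forall b, exists X : set K,
      ~ (forall X, U b [set a | ~ X a] <-> ~ U b X) -> ~ (U b [set a | ~ X a] <-> ~ U b X).
    by move=> b; have [?|/existsNP[X hX]] := pselect (forall X, U b [set a | ~ X a] <-> ~ U b X);
      [exists set0|exists X].
  have [Y hY] := nm_glue nW X.
  have : W [set b | ~ (U b [set a | ~ Y a] <-> ~ U b Y)].
    apply: (nm_sub nW) ((nm_and nW _ _).2 (conj Wn hY)) => b _ [/hX n YX].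
    rewrite (extU' b Y (X b)) // (extU' b _ [set a | ~ X b a]) //.
    by move=> a /YX /= ->.
  rewrite (nm_not nW) (nm_iff nW) (nm_not nW); apply.
  by rewrite -(sW [set a | ~ Y a]) (nm_not nW) (sW Y).
have andU : W [set b | forall X Y : set K, U b [set a | X a /\ Y a] <-> U b X /\ U b Y].
  apply: contrapT => /(nm_not nW) Wn.
  have /choice[X hX] : forall b, exists X : set K * set K,
      ~ (forall X Y, U b [set a | X a /\ Y a] <-> U b X /\ U b Y) ->
      ~ (U b [set a | X.1 a /\ X.2 a] <-> U b X.1 /\ U b X.2).
    move=> b; have [?|/existsNP[X /existsNP[Y hXY]]] :=
      pselect (forall X Y, U b [set a | X a /\ Y a] <-> U b X /\ U b Y).
      by exists (set0, set0).
    by exists (X, Y).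
  have [Y1 hY1] := nm_glue nW (fun b => (X b).1).
  have [Y2 hY2] := nm_glue nW (fun b => (X b).2).
  have : W [set b | ~ (U b [set a | Y1 a /\ Y2 a] <-> U b Y1 /\ U b Y2)].
    have := (nm_and nW _ _).2 (conj Wn ((nm_and nW _ _).2 (conj hY1 hY2))).
    apply: (nm_sub nW) => b _ [/hX n [YX1 YX2]].
    rewrite (extU' b Y1 (X b).1) // (extU' b Y2 (X b).2) //.
    rewrite (extU' b _ [set a | (X b).1 a /\ (X b).2 a]) // => a ab /=.
    by rewrite YX1 // YX2.
  rewrite (nm_not nW) (nm_iff nW) (nm_and nW); apply.
  by rewrite -(sW [set a | Y1 a /\ Y2 a]) (nm_and nW) (sW Y1) (sW Y2).
have gtU : W [set b | forall a, a < b -> U b [set c | a < c]].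
  apply: (nm_diag nW) => a Da.
  exact: (sW [set c | a < c]).1 (nm_gt nW Da).
have regressU : W [set b | forall P : K -> K -> Prop,
    U b [set a | exists c, c < a /\ P a c] -> exists c, c < b /\ U b [set a | P a c]].
  apply: contrapT => /(nm_not nW) Wn.
  have /choice[P hP] : forall b, exists P : K -> K -> Prop,
      ~ (forall P : K -> K -> Prop,
      U b [set a | exists c, c < a /\ P a c] -> exists c, c < b /\ U b [set a | P a c]) ->
      U b [set a | exists c, c < a /\ P a c] /\ forall c, c < b -> ~ U b [set a | P a c].
    move=> b; have [?|/existsNP[P hP]] := pselect (forall P : K -> K -> Prop,
      U b [set a | exists c, c < a /\ P a c] -> exists c, c < b /\ U b [set a | P a c]).
      by exists (fun _ _ => True).
    exists P => _; split=> [|c cb UP]; first by apply: contrapT => nU; apply: hP => /nU.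
    by apply: hP => _; exists c.
  have [Y hY] := nm_glue2 nW P.
  have Wbad : W [set b | U b [set a | exists c, c < a /\ Y a c] /\
      forall c, c < b -> ~ U b [set a | Y a c]].
    apply: (nm_sub nW) ((nm_and nW _ _).2 (conj Wn hY)) => b _ [/hP[UP nUP] YP]; split.
      apply: extU UP => a ab; split=> -[c [ca h]]; exists c; split=> //;
        by apply/(YP a ab c) => //; apply: lt_trans ab.
    move=> c cb UY; apply: (nUP c cb); apply: extU UY => a ab.
    exact: YP.
  (* By [self_representing], the glued relation [Y] is regressive on a [W]-large set; its constant
     value [c] contradicts [Wbad] at almost every [b > c]. *)
  have [W1 W2] := (nm_and nW _ _).1 Wbad.
  have [c [Dc Wc]] := nm_regress nW ((sW _).2 W1).
  have := (nm_and nW _ _).2 (conj (nm_gt nW Dc) ((nm_and nW _ _).2 (conj W2 ((sW _).1 Wc)))).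
  by move=> /(nm_ex nW)[b [_ [cb [/(_ c cb)]]]].
have selfU : W [set b | forall X, U b X <-> U b [set a | U a X]].
  apply: contrapT => /(nm_not nW) Wn.
  have /choice[X hX] : forall b, exists X : set K,
      ~ (forall X, U b X <-> U b [set a | U a X]) -> ~ (U b X <-> U b [set a | U a X]).
    by move=> b; have [?|/existsNP[X hX]] := pselect (forall X, U b X <-> U b [set a | U a X]);
      [exists set0|exists X].
  have [Y hY] := nm_glue nW X.
  have : W [set b | ~ (U b Y <-> U b [set a | U a Y])].
    apply: (nm_sub nW) ((nm_and nW _ _).2 (conj Wn hY)) => b _ [/hX n YX].
    rewrite (extU' b Y (X b)) // (extU' b [set a | U a Y] [set a | U a (X b)]) // => a ab /=.
    by apply: extU' => c ca; apply: YX; apply: lt_trans ab.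
  (* Self-representation applied to [[set a | U a Y]] and then to [Y] turns both sides into
     [W Y]. *)
  rewrite (nm_not nW) (nm_iff nW); apply.
  by rewrite -(sW [set a | U a Y]) -(sW Y).
have := (nm_and nW _ _).2 (conj notU ((nm_and nW _ _).2 (conj andU
  ((nm_and nW _ _).2 (conj gtU ((nm_and nW _ _).2 (conj regressU selfU))))))).
move=> /(nm_ex nW)[b [Db [hnot [hand [hgt [hreg hself]]]]]].
by exists b; split=> //; split=> //; apply: extU.
Qed.

Lemma no_self_representing (wfK : well_founded (fun a b : K => a < b)) D W U :
  (forall b (X Y : set K), (forall a, a < b -> (X a <-> Y a)) -> U b X -> U b Y) ->
  normal_measure D W -> ~ self_representing W U.
Proof.
move=> extU nW sW; have [b [_]] := self_representing_reflects extU nW sW.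
elim/(well_founded_induction wfK): b => b IH nb sb.
have [a [ab na sa]] := self_representing_reflects extU nb sb.
exact: IH ab na sa.
Qed.
End NormalMeasure.

(** * Equality and membership in the universe of sets *)

Lemma Veq_refl x : Veq x x.
Proof. by elim: x => A f IH; split=> a; exists a. Qed.

Lemma Veq_sym x y : Veq x y -> Veq y x.
Proof.
elim: x y => A f IH [B g] [h1 h2]; split.
  by move=> b; have [a /IH] := h2 b; exists a.
by move=> a; have [b /IH] := h1 a; exists b.
Qed.

Lemma Veq_trans x y z : Veq x y -> Veq y z -> Veq x z.
Proof.
elim: x y z => A f IH [B g] [C h] [h1 h2] [k1 k2]; split.
  by move=> a; have [b fg] := h1 a; have [c gh] := k1 b; exists c; apply: IH fg gh.
by move=> c; have [b gh] := k2 c; have [a fg] := h2 b; exists a; apply: IH fg gh.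
Qed.

Lemma Vmem_Veq x x' y y' : Veq x x' -> Veq y y' -> Vmem x y -> Vmem x' y'.
Proof.
case: y y' => [B g] [C h] xx' [h1 _] [b xb]; have [c gh] := h1 b; exists c.
exact: Veq_trans (Veq_sym xx') (Veq_trans xb gh).
Qed.

Lemma Veq_ext x y : Veq x y <-> forall z, Vmem z x <-> Vmem z y.
Proof.
split=> [xy z|].
  by split; apply: Vmem_Veq (Veq_refl z) _ => //; apply: Veq_sym.
case: x y => [A f] [B g] h; split=> [a|b].
  by have [/(_ (ex_intro _ a (Veq_refl _)))] := h (f a).
have [_ /(_ (ex_intro _ b (Veq_refl _)))[a ga]] := h (g b).
by exists a; apply: Veq_sym.
Qed.

Lemma Vmem_wf : well_founded Vmem.
Proof.
(* Members are known only up to [Veq], so accessibility is proved for the whole equality class. *)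
move=> x; suff : forall y, Veq y x -> Acc Vmem y by apply; apply: Veq_refl.
elim: x => A f IH y yx; constructor=> z zy.
by have [a za] := Vmem_Veq (Veq_refl z) yx zy; apply: IH za.
Qed.

(** * Truncation, and codes of ordinals and their subsets *)

Section Hbelow.
Context {d : Order.disp_t} {K : orderType d}.

(* The analogue of [Hplus] for the ordinal [b] in place of the cardinal [K]. *)
Definition Hbelow (b : K) (x : V) : Prop :=
  exists f : K -> V, forall y, intc y x -> exists a, a < b /\ Veq y (f a).

(* The collapse of [x] over the sets enumerated by [f] before [b]. *)
Fixpoint trunc (f : K -> V) (b : K) (x : V) : V :=
  let: sup A g := x in
  @sup {a : A | exists c, c < b /\ Veq (g a) (f c)} (fun a => trunc f b (g (sval a))).

Lemma trunc_Veq f b x y : Veq x y -> Veq (trunc f b x) (trunc f b y).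
Proof.
elim: x y => A g IH [B h] [gh hg]; split=> -[a [c [cb ac]]] /=.
  have [a' aa'] := gh a; have hc : exists c, c < b /\ Veq (h a') (f c).
    by exists c; split=> //; apply: Veq_trans (Veq_sym aa') ac.
  by exists (exist _ a' hc); apply: IH.
have [a' aa'] := hg a; have hc : exists c, c < b /\ Veq (g a') (f c).
  by exists c; split=> //; apply: Veq_trans aa' ac.
by exists (exist _ a' hc); apply: IH.
Qed.

(** Truncation keeps only members listed before [b], so the sets [trunc f b (f c)] with [c < b]
    enumerate the transitive closure. *)
Lemma Hbelow_trunc f b x : Hbelow b (trunc f b x).
Proof.
exists (fun c => trunc f b (f c)) => y yx.
suff : forall y z, intc y z -> forall x, Veq z (trunc f b x) ->
    exists a, a < b /\ Veq y (trunc f b (f a)).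
  by move=> /(_ y _ yx x); apply; apply: Veq_refl.
move=> {x} {}y {yx} z; elim=> {y z} [y z yz [A g] zx|x y z _ IHx _ IHy w zw].
  have [[a [c [cb ac]]] /= ya] := Vmem_Veq (Veq_refl y) zx yz.
  by exists c; split=> //; apply: Veq_trans ya _; apply: trunc_Veq.
by have [a [_ ya]] := IHy _ zw; apply: IHx ya.
Qed.

Context (wfK : well_founded (fun a b : K => a < b)).

Lemma vNE a : vN wfK a = @sup {b : K | b < a} (fun b => vN wfK (sval b)).
Proof.
rewrite /vN Fix_eq // => {}a f g fg.
have -> // : f = g by apply: functional_extensionality_dep => b;
  apply: functional_extensionality_dep => ba; apply: fg.
Qed.

Lemma Vmem_vN y a : Vmem y (vN wfK a) <-> exists b, b < a /\ Veq y (vN wfK b).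
Proof.
rewrite vNE; split=> [[[b ba] yb]|[b [ba yb]]]; first by exists b.
by exists (exist _ b ba).
Qed.

Lemma Vmem_vset y X : Vmem y (vset wfK X) <-> exists b, X b /\ Veq y (vN wfK b).
Proof.
split=> [[[b ba] yb]|[b [ba yb]]]; first by exists b.
by exists (exist _ b ba).
Qed.

Lemma vN_inj a b : Veq (vN wfK a) (vN wfK b) -> a = b.
Proof.
have irr c e : c < e -> ~ Veq (vN wfK c) (vN wfK e).
  move=> ce eq; have : Vmem (vN wfK c) (vN wfK c).
    apply: Vmem_Veq (Veq_refl _) (Veq_sym eq) _.
    by apply/Vmem_vN; exists c; split=> //; apply: Veq_refl.
  elim/(well_founded_induction Vmem_wf): (vN wfK c) => x IH xx; exact: (IH x xx xx).
by have [/irr h /h|/irr h /Veq_sym/h|] := ltgtP a b.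
Qed.

Lemma vset_inj X Y : Veq (vset wfK X) (vset wfK Y) -> X = Y.
Proof.
suff sub Z T : Veq (vset wfK Z) (vset wfK T) -> Z `<=` T.
  by move=> XY; apply/seteqP; split; apply: sub => //; apply: Veq_sym.
move=> ZT a Za; have : Vmem (vN wfK a) (vset wfK T).
  apply: Vmem_Veq (Veq_refl _) ZT _.
  by apply/Vmem_vset; exists a; split=> //; apply: Veq_refl.
by move=> /Vmem_vset[b [Tb /vN_inj ->]].
Qed.

Lemma intc_vset y X : intc y (vset wfK X) -> exists a, (exists b, X b /\ a <= b) /\ Veq y (vN wfK a).
Proof.
suff h : forall y z, intc y z -> (forall a, Veq z (vN wfK a) -> exists b, b < a /\ Veq y (vN wfK b))
  /\ (Veq z (vset wfK X) -> exists a, (exists b, X b /\ a <= b) /\ Veq y (vN wfK a)).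
  by move=> /h[_]; apply; apply: Veq_refl.
move=> {}y z; elim=> {y z} [y z yz|x y z _ [IHx _] _ [IHy IHX]]; split.
- by move=> a za; apply/Vmem_vN; apply: Vmem_Veq (Veq_refl y) za yz.
- move=> zX; have /Vmem_vset[b [Xb yb]] := Vmem_Veq (Veq_refl y) zX yz.
  by exists b; split=> //; exists b.
- move=> a /IHy[b [ba /IHx[c [cb xc]]]]; exists c; split=> //; exact: lt_trans ba.
- move=> /IHX[a [[b [Xb ab]] /IHx[c [ca xc]]]]; exists c; split=> //.
  by exists b; split=> //; apply: le_trans ab; apply: ltW.
Qed.

Lemma Hplus_vset X : Hplus K (vset wfK X).
Proof. by exists (vN wfK) => y /intc_vset[a [_ ya]]; exists a. Qed.
End Hbelow.

(** * The collapsed ultrapower and the theorem of Los *)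

Section Los.
Context {d : Order.disp_t} {K : orderType d}.
Context (wfK : well_founded (fun a b : K => a < b)).
Context (W : set (set K)) (nW : normal_measure [set: K] W).
Hypothesis sigmaW : forall P : nat -> K -> Prop,
  (forall n, W [set b | P n b]) -> W [set b | forall n, P n b].
Implicit Types xs ys zs : K -> V.

(* [x] is the element of the collapsed ultrapower of the universe by [W] which is
   represented by the function [xs]. *)
Fixpoint represents (x : V) xs : Prop :=
  let: sup A f := x in
  (forall a, exists ys, represents (f a) ys /\ W [set b | Vmem (ys b) (xs b)]) /\
  (forall ys, W [set b | Vmem (ys b) (xs b)] -> exists a, represents (f a) ys).

Lemma represents_Vmem x xs ys : represents x xs -> W [set b | Vmem (ys b) (xs b)] ->
  exists y, Vmem y x /\ represents y ys.
Proof.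
case: x => A f [_ h] /h[a fa]; exists (f a); split=> //.
by exists a; apply: Veq_refl.
Qed.

Lemma represents_Veq x y xs : Veq x y -> represents x xs -> represents y xs.
Proof.
elim: x y xs => A f IH [B g] xs [fg gf] [h1 h2]; split.
  move=> b; have [a ab] := gf b; have [ys [fys yx]] := h1 a.
  by exists ys; split=> //; apply: IH fys.
move=> ys /h2[a fys]; have [b ab] := fg a; exists b; exact: IH fys.
Qed.

Lemma represents_ext x xs ys : W [set b | Veq (xs b) (ys b)] ->
  represents x xs -> represents x ys.
Proof.
case: x => A f Wxy [h1 h2]; split.
  move=> a; have [zs [fzs zx]] := h1 a; exists zs; split=> //.
  apply: (nm_sub nW _ ((nm_and nW _ _).2 (conj zx Wxy))) => b _ [/[swap]].
  exact: Vmem_Veq (Veq_refl _).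
move=> zs zy; apply: h2.
apply: (nm_sub nW _ ((nm_and nW _ _).2 (conj zy Wxy))) => b _ [/[swap]/Veq_sym].
exact: Vmem_Veq (Veq_refl _).
Qed.

Lemma represents_inj x y zs : represents x zs -> represents y zs -> Veq x y.
Proof.
elim: x y zs => A f IH [B g] zs [hf1 hf2] [hg1 hg2]; split.
  by move=> a; have [us [fus /hg2[b gus]]] := hf1 a; exists b; apply: IH fus gus.
by move=> b; have [us [gus /hf2[a fus]]] := hg1 b; exists a; apply: IH fus gus.
Qed.

Lemma represents_eq x y xs ys : represents x xs -> represents y ys ->
  (Veq x y <-> W [set b | Veq (xs b) (ys b)]).
Proof.
move=> xxs yys; split; last first.
  by move=> /represents_ext/(_ xxs)/represents_inj; apply.
elim: x y xs ys xxs yys => A f IH y xs ys xxs yys xy.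
have sub us : W [set b | Vmem (us b) (xs b)] <-> W [set b | Vmem (us b) (ys b)].
  split=> h.
    have [_ /(_ _ h)[a fus]] := xxs.
    have : Vmem (f a) y.
      by apply: Vmem_Veq (Veq_refl _) xy _; exists a; apply: Veq_refl.
    case: y yys {xy} => B g [hg _] [e fg]; have [vs [gvs vy]] := hg e.
    have eqW := IH _ _ _ _ fus gvs fg.
    apply: (nm_sub nW _ ((nm_and nW _ _).2 (conj eqW vy))) => b _ [/Veq_sym uv].
    exact: Vmem_Veq uv (Veq_refl _).
  have [z [zy zus]] := represents_Vmem yys h.
  have [a za] := Vmem_Veq (Veq_refl z) (Veq_sym xy) zy.
  have [/(_ a)[vs [fvs vx]] _] := xxs.
  have eqW := IH _ _ _ _ fvs zus (Veq_sym za).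
  apply: (nm_sub nW _ ((nm_and nW _ _).2 (conj eqW vx))) => b _ [uv].
  exact: Vmem_Veq uv (Veq_refl _).
apply: contrapT => /(nm_not nW) Wn.
(* Picking, wherever [xs b] and [ys b] differ, a member of exactly one of them contradicts [sub]. *)
have /choice[us hus] : forall b, exists z,
    ~ Veq (xs b) (ys b) -> ~ (Vmem z (xs b) <-> Vmem z (ys b)).
  move=> b; have [eqb|/Veq_ext/existsNP[z hz]] := pselect (Veq (xs b) (ys b)).
    by exists (xs b).
  by exists z.
have : W [set b | ~ (Vmem (us b) (xs b) <-> Vmem (us b) (ys b))].
  by apply: (nm_sub nW _ Wn) => b _; apply: hus.
by rewrite (nm_not nW) (nm_iff nW) sub; apply.
Qed.

Lemma represents_mem x y xs ys : represents x xs -> represents y ys ->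
  (Vmem x y <-> W [set b | Vmem (xs b) (ys b)]).
Proof.
case: y => B g xxs yys; split=> [[e xg]|h].
  have [/(_ e)[zs [gzs zy]] _] := yys.
  have /(represents_eq xxs gzs) eqW := xg.
  apply: (nm_sub nW _ ((nm_and nW _ _).2 (conj eqW zy))) => b _ [/Veq_sym xz].
  exact: Vmem_Veq xz (Veq_refl _).
have [z [zy zxs]] := represents_Vmem yys h.
by apply: Vmem_Veq zy; [apply: represents_inj zxs xxs|apply: Veq_refl].
Qed.

Definition Vindex (x : V) : Type := let: sup A _ := x in A.
Definition Velt (x : V) : Vindex x -> V := let: sup _ f := x in f.

Lemma Vmem_Velt y x : Vmem y x <-> exists i, Veq y (@Velt x i).
Proof. by case: x. Qed.

Lemma represents_sup xs :
  (forall ys, W [set b | Vmem (ys b) (xs b)] -> exists y, represents y ys) ->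
  exists x, represents x xs.
Proof.
(* The index type of a set must live in a smaller universe than [V], so choices of members are coded
   by indices; [None] allows for empty [xs b]. *)
move=> hxs; pose T := {s : forall b, option (Vindex (xs b)) | W [set b | s b <> None]}.
pose fam (s : T) b := if sval s b is Some i then Velt i else xs b.
have famW s : W [set b | Vmem (fam s b) (xs b)].
  apply: (nm_sub nW _ (svalP s)) => b _; rewrite /fam; case: (sval s b) => // i _.
  by apply/Vmem_Velt; exists i; apply: Veq_refl.
have /choice[r hr] : forall s, exists y, represents y (fam s) by move=> s; apply: hxs.
exists (sup r); split=> [s|ys ysx]; first by exists (fam s).
have hs b : exists o : option (Vindex (xs b)),
    Vmem (ys b) (xs b) -> exists2 i, o = Some i & Veq (ys b) (Velt i).
  have [/Vmem_Velt[i yi]|nm] := pselect (Vmem (ys b) (xs b)); last by exists None.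
  by exists (Some i) => _; exists i.
pose s b := sval (cid (hs b)).
have sP b : Vmem (ys b) (xs b) -> exists2 i, s b = Some i & Veq (ys b) (Velt i).
  exact: svalP (cid (hs b)).
have Ws : W [set b | s b <> None].
  by apply: (nm_sub nW _ ysx) => b _ /sP[i ->].
exists (exist _ s Ws); apply: represents_ext (hr _).
apply: (nm_sub nW _ ysx) => b _ /sP[i si yi]; rewrite /fam /= si.
exact: Veq_sym.
Qed.

(** The ultrapower is well-founded: an unrepresented function has an unrepresented member, and
    iterating this gives, by [sigmaW], an infinite membership descent at a single [b]. *)
Lemma represents_exists xs : exists x, represents x xs.
Proof.
apply: contrapT => nx.
have /choice[g hg] : forall ys, exists zs, ~ (exists y, represents y ys) ->
    W [set b | Vmem (zs b) (ys b)] /\ ~ (exists z, represents z zs).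
  move=> ys; apply: contrapT => nz; apply: (nz); exists ys => ny; case: ny.
  apply: represents_sup => zs zy; apply: contrapT => nzs.
  by apply: nz; exists zs.
pose us n := iter n g xs.
have nus n : ~ (exists x, represents x (us n)) by elim: n => // n /hg[].
have [b [_ desc]] := nm_ex nW (sigmaW (fun n => (hg _ (nus n)).1)).
suff : forall x n, x = us n b -> False by move=> /(_ _ 0%N erefl).
move=> x; elim/(well_founded_induction Vmem_wf): x => x IH n xn.
by apply: IH (erefl (us n.+1 b)); rewrite xn; apply: desc.
Qed.

Lemma represents_intc y x xs : intc y x -> represents x xs ->
  exists ys, represents y ys /\ W [set b | intc (ys b) (xs b)].
Proof.
move=> h; elim: h xs => {x y} [y [A f] [a ya] xs [/(_ a)[ys [fys Wy]] _]|x y z _ IHx _ IHy xs].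
  exists ys; split; first exact: represents_Veq (Veq_sym ya) fys.
  by apply: (nm_sub nW _ Wy) => b _; apply: t_step.
move=> /IHy[ys [/IHx[zs [xzs Wzs]] Wys]]; exists zs; split=> //.
apply: (nm_sub nW _ ((nm_and nW _ _).2 (conj Wzs Wys))) => b _ [].
exact: t_trans.
Qed.

(** Enumerations [F b] of the transitive closures of the [xs b] give one for [x]: its term at [c] is
    represented by [F b c] as a function of [b], and normality fixes the index at which a given
    member occurs. *)
Lemma represents_Hplus x xs : W [set b | Hbelow b (xs b)] -> represents x xs -> Hplus K x.
Proof.
move=> Wxs xxs.
have /choice[F hF] : forall b, exists f : K -> V, Hbelow b (xs b) ->
    forall y, intc y (xs b) -> exists a, a < b /\ Veq y (f a).
  by move=> b; have [[f hf]|nf] := pselect (Hbelow b (xs b)); [exists f|exists (fun=> xs b)].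
have /choice[G hG] : forall c, exists y, represents y (fun b => F b c).
  by move=> c; apply: represents_exists.
exists G => y yx; have [ys [yys Wys]] := represents_intc yx xxs.
have [|c [_ Wc]] := @nm_regress _ _ _ _ nW (fun b c => Veq (ys b) (F b c)).
  apply: (nm_sub nW _ ((nm_and nW _ _).2 (conj Wxs Wys))) => b _ [].
  by move=> /hF h /h.
by exists c; apply: represents_inj (represents_ext Wc yys) (hG c).
Qed.

(** A member of [x] survives truncation once [b] passes its index under [f]; conversely, a choice of
    members has regressive indices, so almost everywhere it truncates one fixed member. *)
Lemma represents_trunc (f : K -> V) x :
  (forall y, intc y x -> exists c, Veq y (f c)) -> represents x (fun b => trunc f b x).
Proof.
elim: x => A g IH hf.
have hg a : exists c, Veq (g a) (f c).
  by apply: hf; apply: t_step; exists a; apply: Veq_refl.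
have IHg a : represents (g a) (fun b => trunc f b (g a)).
  apply: IH => y yg; apply: hf; apply: t_trans yg _.
  by apply: t_step; exists a; apply: Veq_refl.
split=> [a|ys Wys].
  exists (fun b => trunc f b (g a)); split=> //.
  have [c gc] := hg a; apply: (nm_sub nW _ (nm_gt nW (a := c) _)) => // b _ cb.
  have hc : exists c, c < b /\ Veq (g a) (f c) by exists c.
  by exists (exist _ a hc); apply: Veq_refl.
have [|c [_ Wc]] := @nm_regress _ _ _ _ nW
    (fun b c => exists a, Veq (g a) (f c) /\ Veq (ys b) (trunc f b (f c))).
  apply: (nm_sub nW _ Wys) => b _ [[a [c [cb ac]]] /= ya].
  by exists c; split=> //; exists a; split=> //; apply: Veq_trans ya (trunc_Veq _ _ ac).
have [b [_ [a [ac _]]]] := nm_ex nW Wc.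
exists a; apply: represents_ext (IHg a).
apply: (nm_sub nW _ Wc) => {}b _ [_ [_ yc]].
by apply: Veq_trans (trunc_Veq f b ac) (Veq_sym yc).
Qed.

(** A function with values below [a] is regressive beyond [a], hence almost everywhere constant: the
    ultrapower does not move the ordinals in [K]. *)
Lemma represents_vN a : represents (vN wfK a) (fun=> vN wfK a).
Proof.
elim/(well_founded_induction wfK): a => a IH; rewrite [X in represents X]vNE.
split=> [[b ba]|ys Wys].
  exists (fun=> vN wfK b); split; first exact: IH.
  by apply: (nm_all nW) => c _; apply/Vmem_vN; exists b; split=> //; apply: Veq_refl.
have [|b [_ Wb]] := @nm_regress _ _ _ _ nW (fun c b => b < a /\ Veq (ys c) (vN wfK b)).
  apply: (nm_sub nW _ ((nm_and nW _ _).2 (conj Wys (nm_gt nW (a := a) _)))) => // c _.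
  move=> [/Vmem_vN[b [ba yb]] ac]; exists b; split=> //; exact: lt_trans ac.
have [c [_ [ba _]]] := nm_ex nW Wb.
exists (exist _ b ba) => /=; apply: represents_ext (IH _ ba).
by apply: (nm_sub nW _ Wb) => {}c _ [_ /Veq_sym].
Qed.

Lemma represents_vset (X : set K) :
  represents (vset wfK X) (fun b => vset wfK (X `&` [set c | c < b])).
Proof.
split=> [[a Xa]|ys Wys].
  exists (fun=> vN wfK a); split; first exact: represents_vN.
  apply: (nm_sub nW _ (nm_gt nW (a := a) _)) => // b _ ab.
  by apply/Vmem_vset; exists a; split=> //; apply: Veq_refl.
have [|a [_ Wa]] := @nm_regress _ _ _ _ nW (fun b a => X a /\ Veq (ys b) (vN wfK a)).
  by apply: (nm_sub nW _ Wys) => b _ /Vmem_vset[a [[Xa ab] ya]]; exists a.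
have [b [_ [Xa _]]] := nm_ex nW Wa.
exists (exist _ a Xa) => /=; apply: represents_ext (represents_vN a).
by apply: (nm_sub nW _ Wa) => {}b _ [_ /Veq_sym].
Qed.

Lemma represents_upd (e : nat -> V) (es : K -> nat -> V) i x xs :
  (forall j, represents (e j) (es^~ j)) -> represents x xs ->
  forall j, represents (upd e i x j) (fun b => upd (es b) i (xs b) j).
Proof. by move=> he hx j; rewrite /upd; case: eqP. Qed.

Lemma sat_Los p (e : nat -> V) (es : K -> nat -> V) :
  (forall j, represents (e j) (es^~ j)) ->
  (sat (Hplus K) e p <-> W [set b | sat (Hbelow b) (es b) p]).
Proof.
elim: p e es => [i j|i j|p IH|p IHp q IHq|i p IH] e es he /=.
- exact: represents_mem.
- exact: represents_eq.
- by rewrite (nm_not nW) (IH _ _ he).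
- by rewrite (nm_and nW) (IHp _ _ he) (IHq _ _ he).
split=> [h|h x [f hf]].
  (* Counterexamples [xs b] taken in almost every [Hbelow b] represent a counterexample in
     [Hplus K]. *)
  apply: contrapT => /(nm_not nW) Wn.
  have /choice[xs hxs] : forall b, exists x,
      ~ (forall x, Hbelow b x -> sat (Hbelow b) (upd (es b) i x) p) ->
      Hbelow b x /\ ~ sat (Hbelow b) (upd (es b) i x) p.
    move=> b; have [?|/existsNP[x /not_implyP hx]] := pselect
      (forall x, Hbelow b x -> sat (Hbelow b) (upd (es b) i x) p).
      by exists (es b 0%N).
    by exists x.
  have : W [set b | Hbelow b (xs b) /\ ~ sat (Hbelow b) (upd (es b) i (xs b)) p].
    by apply: (nm_sub nW _ Wn) => b _ /hxs.
  move=> /(nm_and nW)[Wxs /(nm_not nW)]; apply.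
  have [x xxs] := represents_exists xs.
  apply/(IH (upd e i x)); first exact: represents_upd.
  by apply: h; apply: represents_Hplus xxs.
(* Truncations represent [x] while lying in [Hbelow b] at every [b], so the hypothesis applies to
   them. *)
apply/(IH _ (fun b => upd (es b) i (trunc f b x))).
  by apply: represents_upd => //; apply: represents_trunc.
by apply: (nm_sub nW _ h) => b _; apply; apply: Hbelow_trunc.
Qed.

(** [U b] is what the defining formula of [I] defines in [Hbelow b], each parameter being replaced
    by the value at [b] of a function representing it. *)
Lemma definable_over_Hplus_sequence (I : set (set K)) : definable_over_Hplus wfK I ->
  exists U : K -> set (set K),
    forall X, I X <-> W [set b | U b (X `&` [set a | a < b])].
Proof.
move=> [p [e [he hp]]].
have /choice[es hes] : forall i, exists xs, represents (e i) xs.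
  move=> i; have [f hf] := he i; exists (fun b => trunc f b (e i)).
  exact: represents_trunc.
exists (fun b X => sat (Hbelow b) (upd (es^~ b) 0%N (vset wfK X)) p) => X.
transitivity (sat (Hplus K) (upd e 0%N (vset wfK X)) p).
  rewrite -hp; last exact: Hplus_vset.
  by split=> [IX|[Y IY /vset_inj ->//]]; exists X => //; apply: Veq_refl.
apply: (@sat_Los p _ (fun b => upd (es^~ b) 0%N (vset wfK (X `&` [set c | c < b])))).
by apply: represents_upd => //; apply: represents_vset.
Qed.
End Los.

(** * From an atom of the ideal to a self-representing measure *)

Theorem corollary4p3 (d : Order.disp_t) (K : orderType d)
    (wfK : well_founded (fun a b : K => (a < b)%O))
    (I : set (set K)) :
  weakly_compact K -> normal_ideal I -> definable_over_Hplus wfK I ->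
  nowhere_saturated I.
Proof.
move=> [cardK uncK partK] nI defI S pS satS.
have [A [_ pA atomA]] := saturated_atom wfK cardK uncK nI partK pS satS.
pose W : set (set K) := [set X | ~ I (A `&` X)].
(* The atom property makes [W] an ultrafilter: if [A] meets [X] positively, then [X] contains almost
   all of [A]. *)
have setDW X : W X -> I (A `\` X) by case: (atomA X).
have nullU := @null_setU _ _ _ nI; have sub := @null_sub _ _ _ nI.
have nW : normal_measure [set: K] W.
  split=> [X Y XY|P|P Q|a _|P WP].
  - by have -> : X = Y by apply/seteqP; split=> a; apply XY.
  - split=> [WnP WP|nWP IAnP].
      by apply: WnP; apply: sub (setDW _ WP) => b [Ab nPb]; split.
    apply: nWP => IAP; apply: pA; apply: sub (nullU _ _ IAnP IAP) => b Ab.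
    by have [Pb|nPb] := pselect (P b); [right|left].
  - split=> [WPQ|[WP WQ] IPQ].
      by split=> IA; apply: WPQ; apply: sub IA => b [Ab []].
    apply: pA; apply: sub (nullU _ _ IPQ (nullU _ _ (setDW _ WP) (setDW _ WQ))) => b Ab.
    have [Pb|nPb] := pselect (P b); last by right; left.
    by have [Qb|nQb] := pselect (Q b); [left|right; right].
  - move=> IA; apply: pA; apply: sub (nullU _ _ IA (null_le cardK uncK nI a)) => b Ab.
    by have [ab|ba] := ltP a b; [left|right].
  - have [b []|c pc] := regressive_relation nI (Q := P) WP; first by [].
    exists c; split=> //; apply: (positive_sub nI) pc => b [[Ab _] Pb]; by split.
have sigmaW (P : nat -> K -> Prop) :
    (forall n, W [set b | P n b]) -> W [set b | forall n, P n b].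
  move=> WP IA; apply: pA.
  apply: sub (nullU _ _ IA (null_bigcup_nat uncK nI (fun n => setDW _ (WP n)))) => b Ab.
  have [Pb|/existsNP[n nPb]] := pselect (forall n, P n b); [by left|right].
  by exists n.
have [U hU] := definable_over_Hplus_sequence nW sigmaW defI.
(* [U] represents the ideal [I]; intersecting with [A] and negating gives a sequence representing
   [W]. *)
apply: (@no_self_representing _ _ wfK _ _
  (fun b => [set X | ~ U b ((A `&` X) `&` [set a | a < b])]) _ nW) => [b X Y XY|X].
  suff /= -> : A `&` X `&` [set a | a < b] = A `&` Y `&` [set a | a < b] by [].
  by apply/seteqP; split=> a [[Aa Xa] ab]; do !split=> //; apply/XY.
by rewrite (nm_not nW) -hU.
Qed.
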